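(* The only admissible $2$-partitions of the Coxeter graphs $F_4$, $H_3$, $H_4$ and $I_2(m)$, $m\geq3$, are the bipartite ones and the $2$-partition of $F_4$ given by the orbits of the non-trivial automorphism of $F_4$, i.e. $\{\{1,4\},\{2,3\}\}$ where $F_4$ is the path $1-2-3-4$ with $m_{1,2}=m_{3,4}=3$ and $m_{2,3}=4$. That is, for $\Gamma$ of one of these types, a $2$-partition of the vertex set is admissible if and only if it is the bipartite partition of $\Gamma$, or $\Gamma=F_4$ and it is $\{\{1,4\},\{2,3\}\}$.
   Context: A Coxeter matrix over a set $I$ is a family $\Gamma=(m_{i,j})_{i,j\in I}$ with $m_{i,j}=m_{j,i}\in\mathbb N_{\geq 1}\cup\{\infty\}$ and $m_{i,j}=1\iff i=j$; its Coxeter graph has vertex set $I$, an edge $\{i,j\}$ when $m_{i,j}\ge3$, labelled by $m_{i,j}$ when $m_{i,j}\geq 4$. $F_4$, $H_3$, $H_4$, $I_2(m)$ ($m$ a finite integer $\ge 3$; two vertices joined by an edge labelled $m$) are the usual irreducible spherical (finite type) Coxeter graphs. $W=W_\Gamma$ is the associated Coxeter group with generators $s_i$ ($i\in I$) and $\ell$ is word length on $W$. For $J\subseteq I$ with $W_J=\langle s_j\mid j\in J\rangle$ finite ($J$ spherical), $r_J$ denotes the unique element of maximal length of $W_J$. A $2$-partition is a partition $\{\alpha,\beta\}$ of $I$ into exactly two (non-empty) parts. It is admissible if $\alpha,\beta$ are spherical and, with $\tilde W=\langle r_\alpha,r_\beta\rangle\subseteq W$, for every $w\in\tilde W$ and every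 $\gamma\in\{\alpha,\beta\}$, either $\ell(ws_i)=\ell(w)+1$ for all $i\in\gamma$, or $\ell(ws_i)=\ell(w)-1$ for all $i\in\gamma$. The bipartite partition of $\Gamma$ (whose graph is a tree) is the unique $2$-partition of $I$ such that no edge joins two vertices of the same part. *)

(* Defs.v *)
From HB Require Import structures.
From mathcomp Require Import all_fingroup all_boot.
From mathcomp Require Import boolp classical_sets cardinality.

Set Implicit Arguments.
Unset Strict Implicit.
Unset Printing Implicit Defensive.

Local Open Scope quotient_scope.

(* An entry [None] stands for infinity. *)
Record coxMatrix (I : finType) := CoxMatrix {
  cox_m :> I -> I -> option nat;
  cox_m_sym : forall i j, cox_m i j = cox_m j i;
  cox_m_neq0 : forall i j, cox_m i j <> Some 0;
  cox_m_eq1 : forall i j, cox_m i j = Some 1 <-> i = j }.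

Definition cox_edge (I : finType) (M : coxMatrix I) (i j : I) : bool :=
  if M i j is Some m then 3 <= m else true.

Section CoxeterGroup.
Variables (I : finType) (M : coxMatrix I).
Implicit Types u v w : seq I.

(* Congruence on words generated by (i j)^(M i j) = 1 for all i, j with M i j
   finite.  As M i i = 1, it contains the relations i i = 1, so the quotient of
   the free monoid on I is already a group, the one presented by these
   relations. *)
Inductive cox_cong : seq I -> seq I -> Prop :=
| CoxRel u v i j m : M i j = Some m ->
    cox_cong (u ++ flatten (nseq m [:: i; j]) ++ v) (u ++ v)
| CoxRefl u : cox_cong u u
| CoxSym u v : cox_cong u v -> cox_cong v u
| CoxTrans v u w : cox_cong u v -> cox_cong v w -> cox_cong u w.

Definition cox_rel : rel (seq I) := fun u v => `[< cox_cong u v >].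

Fact cox_rel_refl : reflexive cox_rel.
Proof. by move=> u; apply/asboolP/CoxRefl. Qed.

Fact cox_rel_sym : symmetric cox_rel.
Proof. by move=> u v; apply/asboolP/asboolP => /CoxSym. Qed.

Fact cox_rel_trans : transitive cox_rel.
Proof.
by move=> v u w /asboolP uv /asboolP vw; apply/asboolP/(CoxTrans uv vw).
Qed.

Canonical cox_equiv := EquivRel cox_rel cox_rel_refl cox_rel_sym cox_rel_trans.

Definition coxgroup := {eq_quot cox_equiv}.
HB.instance Definition _ := Choice.on coxgroup.
HB.instance Definition _ : EqQuotient _ cox_equiv coxgroup :=
  EqQuotient.on coxgroup.

Lemma cox_piP u v : \pi_coxgroup u = \pi_coxgroup v <-> cox_cong u v.
Proof.
split=> uv; first by apply/asboolP/(@eqmodP _ cox_equiv u v).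
by apply/(@eqmodP _ cox_equiv u v)/asboolP.
Qed.

Lemma cox_cong_cat u u' v v' :
  cox_cong u u' -> cox_cong v v' -> cox_cong (u ++ v) (u' ++ v').
Proof.
move=> uu' vv'; apply: (@CoxTrans (u' ++ v)).
  elim: uu' => {u u' vv'} [u1 u2 i j m Mij|u|u1 u2 _ /CoxSym //|u2 u1 u3 _ H1 _].
  - by rewrite -!catA; apply: CoxRel.
  - exact: CoxRefl.
  - exact: CoxTrans.
elim: vv' => {v v' uu'} [u1 u2 i j m Mij|v|u1 u2 _ /CoxSym //|u2 u1 u3 _ H1 _].
- by rewrite !(catA u'); apply: CoxRel.
- exact: CoxRefl.
- exact: CoxTrans.
Qed.

Lemma cox_cong_rev u v : cox_cong u v -> cox_cong (rev u) (rev v).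
Proof.
elim=> {u v} [u v i j m Mij|u|u v _ /CoxSym //|v u w _ H1 _]; last 2 first.
- exact: CoxRefl.
- exact: CoxTrans.
have revE : rev (flatten (nseq m [:: i; j])) = flatten (nseq m [:: j; i]).
  elim: m {Mij} => // m IHm; rewrite -{1}addn1 nseqD flatten_cat rev_cat IHm.
  by [].
by rewrite !rev_cat revE -catA; apply: CoxRel; rewrite cox_m_sym.
Qed.

Lemma cox_cong_revK u : cox_cong (rev u ++ u) [::].
Proof.
elim: u => [|i u IHu]; first exact: CoxRefl.
rewrite rev_cons cat_rcons; apply: CoxTrans IHu.
have Mii : M i i = Some 1 by apply/cox_m_eq1.
exact: (CoxRel (rev u) u Mii).
Qed.

Definition cox_one : coxgroup := \pi_coxgroup [::].
Definition cox_mul (x y : coxgroup) : coxgroup :=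
  \pi_coxgroup (repr x ++ repr y).
Definition cox_inv (x : coxgroup) : coxgroup := \pi_coxgroup (rev (repr x)).

Lemma cox_reprP u : cox_cong (repr (\pi_coxgroup u)) u.
Proof. by apply/cox_piP; rewrite reprK. Qed.

Lemma cox_mulE u v :
  cox_mul (\pi_coxgroup u) (\pi_coxgroup v) = \pi_coxgroup (u ++ v).
Proof. by apply/cox_piP/cox_cong_cat; apply: cox_reprP. Qed.

Fact cox_mulA : associative cox_mul.
Proof.
elim/quotW=> u; elim/quotW=> v; elim/quotW=> w.
by rewrite (cox_mulE v w) (cox_mulE u v) !cox_mulE catA.
Qed.

Fact cox_mul1 : left_id cox_one cox_mul.
Proof. by move=> x; rewrite -[x]reprK cox_mulE. Qed.

Fact cox_mulx1 : right_id cox_one cox_mul.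
Proof. by move=> x; rewrite -[x]reprK cox_mulE cats0. Qed.

Fact cox_mulV : left_inverse cox_one cox_inv cox_mul.
Proof.
move=> x; rewrite -{2}[x]reprK cox_mulE.
exact/cox_piP/cox_cong_revK.
Qed.

Fact cox_mulxV : right_inverse cox_one cox_inv cox_mul.
Proof.
move=> x; rewrite -{1}[x]reprK cox_mulE; apply/cox_piP.
by have := cox_cong_revK (rev (repr x)); rewrite revK.
Qed.

HB.instance Definition _ :=
  isGroup.Build coxgroup cox_mulA cox_mul1 cox_mulx1 cox_mulV cox_mulxV.

Definition cox_gen (i : I) : coxgroup := \pi_coxgroup [:: i].

Lemma cox_prodE u : (\prod_(i <- u) cox_gen i)%g = \pi_coxgroup u.
Proof.
by elim: u => [|i u IHu]; rewrite ?big_nil ?big_cons // IHu; apply: cox_mulE.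
Qed.

Fact cox_length_subproof (w : coxgroup) :
  exists n, `[< exists2 u, size u = n & (\prod_(i <- u) cox_gen i)%g = w >].
Proof.
by exists (size (repr w)); apply/asboolP; exists (repr w); rewrite ?cox_prodE ?reprK.
Qed.

Definition cox_length (w : coxgroup) : nat := ex_minn (cox_length_subproof w).

End CoxeterGroup.

Section Subgroups.
Local Open Scope classical_set_scope.

Definition is_subgroup (G : groupType) (H : set G) : Prop :=
  H 1%g /\ (forall x y, H x -> H y -> H (x * y^-1)%g).

Definition generated_subgroup (G : groupType) (A : set G) : set G :=
  smallest (@is_subgroup G) A.

Variables (I : finType) (M : coxMatrix I).

Definition parabolic (J : {set I}) : set (coxgroup M) :=
  generated_subgroup (@cox_gen I M @` [set` J]).

Definition spherical (J : {set I}) : Prop := finite_set (parabolic J).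

(* Only meaningful for spherical J, where the maximum of the length on W_J is
   attained at exactly one element. *)
Definition longest (J : {set I}) : coxgroup M :=
  xget 1%g [set w | parabolic J w /\
                  forall v, parabolic J v -> cox_length v <= cox_length w].

Definition two_partition (P : {set {set I}}) : Prop :=
  finset.partition P [set: I]%SET /\ #|P| = 2.

Definition admissible (P : {set {set I}}) : Prop :=
  [/\ two_partition P,
      forall J, J \in P -> spherical J
    & forall w, generated_subgroup (longest @` [set` P]) w ->
      forall J, J \in P ->
        (forall i, i \in J ->
           cox_length (w * cox_gen M i)%g = (cox_length w).+1) \/
        (forall i, i \in J ->
           cox_length w = (cox_length (w * cox_gen M i)%g).+1)].

Definition bipartite_partition (P : {set {set I}}) : Prop :=
  two_partition P /\
  forall J, J \in P -> forall i j, i \in J -> j \in J -> ~~ cox_edge M i j.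

Definition cox_automorphism (s : {perm I}) : Prop :=
  forall i j, M (s i) (s j) = M i j.

End Subgroups.

(* The path 0 - 1 - ... - size s whose edge {k, k.+1} has m = s`_k; since the
   entries of s are at least 3, the Coxeter graph is exactly this path. *)
Section PathGraph.
Variables (s : seq nat).

Definition path_m (i j : 'I_(size s).+1) : option nat :=
  Some (if i == j then 1
        else if j == i.+1 :> nat then nth 2 s i
        else if i == j.+1 :> nat then nth 2 s j
        else 2).

Hypothesis s_ge3 : all (leq 3) s.

Fact path_nth_gt1 k : 1 < nth 2 s k.
Proof.
have [ks|sk] := ltnP k (size s); last by rewrite nth_default.
exact: ltnW (all_nthP 2 s_ge3 k ks).
Qed.

Fact path_m_sym i j : path_m i j = path_m j i.
Proof.
rewrite /path_m (eq_sym j i); case: eqP => //= _.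
by have [->|//] := eqVneq (j : nat) i.+1; rewrite ltn_eqF.
Qed.

Fact path_m_neq0 i j : path_m i j <> Some 0.
Proof.
have := (path_nth_gt1 i, path_nth_gt1 j).
by rewrite /path_m; (do 3?case: eqP => //= _) => -[H1 H2] [E];
  rewrite E in H1 H2.
Qed.

Fact path_m_eq1 i j : path_m i j = Some 1 <-> i = j.
Proof.
have := (path_nth_gt1 i, path_nth_gt1 j).
by rewrite /path_m; (do 3?case: eqP => //= ?) => -[H1 H2]; split=> // -[E];
  rewrite E in H1 H2.
Qed.

Definition path_coxMatrix : coxMatrix 'I_(size s).+1 :=
  CoxMatrix path_m_sym path_m_neq0 path_m_eq1.

End PathGraph.

Definition cox_F4 : coxMatrix 'I_4 := @path_coxMatrix [:: 3; 4; 3] isT.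
Definition cox_H3 : coxMatrix 'I_3 := @path_coxMatrix [:: 5; 3] isT.
Definition cox_H4 : coxMatrix 'I_4 := @path_coxMatrix [:: 5; 3; 3] isT.

Fact I2_labels (m : nat) : 3 <= m -> all (leq 3) [:: m].
Proof. by move=> m_ge3; rewrite /= m_ge3. Qed.

Definition cox_I2 (m : nat) (m_ge3 : 3 <= m) : coxMatrix 'I_2 :=
  @path_coxMatrix [:: m] (I2_labels m_ge3).

(* {{1, 4}, {2, 3}} in the numbering 1 - 2 - 3 - 4 of the path. *)
Definition F4_orbits : {set {set 'I_4}} :=
  [set [set inord 0; inord 3]; [set inord 1; inord 2]]%SET.

(* Main.v *)
Require Import Defs.
From HB Require Import structures.
From Stdlib Require Import ZArith.
From mathcomp Require Import all_fingroup all_boot.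
From mathcomp Require Import boolp classical_sets cardinality zify ssrZ.

(* A word is reduced as soon as the reflections attached to its prefixes are
   pairwise distinct, which can be tested in the geometric representation.

   Bipartite partitions and the orbits of F4: both alternating products of
   r_J and r_K with h factors are reduced words, and they represent the same
   element. Hence the elements of <r_J, r_K> are the alternating products
   with at most h factors, along which lengths add up; such a product ending in
   r_J goes down by every s_i with i in J, and up by every s_i with
   i in K unless it is the longest one.

   Other partitions: if c in K commutes with J while b in K does not, then
   w = r_K r_J satisfies l(w s_b) = l(w) + 1 but l(w s_c) < l(w). This excludes
   everything except the partition {{0, 3}, {1, 2}} of H4, for which
   w = (r_K r_J)^2 is such an element. *)

Set Implicit Arguments.
Unset Strict Implicit.
Unset Printing Implicit Defensive.

Local Open Scope group_scope.

(** * Reflections and reduced words *)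

Section Words.
Variables (I : finType) (M : coxMatrix I).
Implicit Types (i j : I) (u v : seq I) (w x y t : coxgroup M).

Definition word u : coxgroup M := \pi_(coxgroup M)%qT u.
Local Notation s_ := (@cox_gen I M).
Local Notation len := (@cox_length I M).

Lemma word_eq u v : word u = word v <-> cox_cong M u v.
Proof. exact: cox_piP. Qed.

Lemma word0 : word [::] = 1. Proof. by []. Qed.

Lemma wordM u v : word (u ++ v) = word u * word v.
Proof. by rewrite /word -cox_mulE. Qed.

Lemma word_cons i u : word (i :: u) = s_ i * word u.
Proof. exact: (wordM [:: i]). Qed.

Lemma gen_invol i : s_ i * s_ i = 1.
Proof.
rewrite -(wordM [:: i] [:: i]) -word0; apply/word_eq.
by apply: (@CoxRel _ _ [::] [::] i i 1); apply/cox_m_eq1.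
Qed.

Lemma gen_inv i : (s_ i)^-1 = s_ i.
Proof. by apply: (mulgI (s_ i)); rewrite mulgV gen_invol. Qed.

Lemma word_rev u : word (rev u) = (word u)^-1.
Proof.
apply: (mulIg (word u)); rewrite mulVg -wordM -word0; apply/word_eq.
exact: cox_cong_revK.
Qed.

Lemma word_surj w : exists u, word u = w.
Proof. by exists (repr w); apply: reprK. Qed.

Lemma length_witness w : exists2 u, size u = len w & word u = w.
Proof.
rewrite /cox_length; case: ex_minnP => n /asboolP[u szu <-] _.
by exists u; rewrite ?cox_prodE.
Qed.

Lemma length_le u : len (word u) <= size u.
Proof.
rewrite /cox_length; case: ex_minnP => n _; apply.
by apply/asboolP; exists u; rewrite ?cox_prodE.
Qed.

Lemma lengthM w x : len (w * x) <= len w + len x.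
Proof.
have [u <- {1}<-] := length_witness w; have [v <- {1}<-] := length_witness x.
by rewrite -wordM -size_cat length_le.
Qed.

Lemma length1 : len 1 = 0.
Proof. by apply/eqP; rewrite -leqn0 (length_le [::]). Qed.

Lemma length_gen i : len (s_ i) <= 1.
Proof. exact: (length_le [:: i]). Qed.

Lemma length_genr w i : len (w * s_ i) <= (len w).+1.
Proof. by rewrite (leq_trans (lengthM _ _)) // -[leqRHS]addn1 leq_add2l length_gen. Qed.

Lemma length_genr_ge w i : len w <= (len (w * s_ i)).+1.
Proof. by rewrite -{1}[w](mulgK (s_ i)) gen_inv length_genr. Qed.

Lemma size_braid_word i j m : size (flatten (nseq m [:: i; j])) = m.*2.
Proof. by elim: m => //= m ->; rewrite doubleS. Qed.

Lemma cong_odd u v : cox_cong M u v -> odd (size u) = odd (size v).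
Proof.
elim=> {u v} // [u v i j m _|u v w _ -> _ ->] //.
by rewrite !size_cat size_braid_word !oddD odd_double.
Qed.

Lemma odd_length u : odd (len (word u)) = odd (size u).
Proof. by have [v <- /word_eq/cong_odd] := length_witness (word u). Qed.

Lemma length_genr_cases w i :
  len (w * s_ i) = (len w).+1 \/ len w = (len (w * s_ i)).+1.
Proof.
have := length_genr w i; rewrite leq_eqVlt ltnS => /orP[/eqP|]; first by left.
have := length_genr_ge w i; rewrite leq_eqVlt ltnS => /orP[/eqP|le1 le2].
  by right.
have /eqP/(congr1 odd) : len w == len (w * s_ i) by rewrite eqn_leq le1 le2.
have [u <-] := word_surj w; rewrite -[s_ i]/(word [:: i]) -wordM !odd_length.
by rewrite size_cat addn1 /=; case: odd.
Qed.

Definition invs_conj x (s : seq (coxgroup M)) := [seq x * t * x^-1 | t <- s].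

(** A letter [i] preceded by the prefix [p] contributes the conjugate of s_i by [word p]; for a
    reduced word these are the left inversions of its element. *)
Fixpoint invs u : seq (coxgroup M) :=
  if u is i :: u' then s_ i :: invs_conj (s_ i) (invs u') else [::].

Lemma invs_conjM x y s : invs_conj (x * y) s = invs_conj x (invs_conj y s).
Proof.
by rewrite /invs_conj -map_comp; apply: eq_map => t /=; rewrite invgM !mulgA.
Qed.

Lemma invs_conj1 s : invs_conj 1 s = s.
Proof.
by rewrite /invs_conj map_id_in // => t _; rewrite invg1 mulg1 mul1g.
Qed.

Lemma mem_invs_conj x t s : (t \in invs_conj x s) = (x^-1 * t * x \in s).
Proof.
apply/mapP/idP => [[r rs ->]|ts]; first by rewrite !mulgA mulVg mul1g mulgKV.
by exists (x^-1 * t * x) => //; rewrite !mulgA mulgV mul1g mulgK.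
Qed.

Lemma invs_conj_inj x : injective (fun t => x * t * x^-1).
Proof. by move=> t r /mulIg/mulgI. Qed.

Lemma count_invs_conj x t s :
  count_mem t (invs_conj x s) = count_mem (x^-1 * t * x) s.
Proof.
rewrite count_map; apply: eq_count => r.
by rewrite -[RHS](inj_eq (@invs_conj_inj x)) /= !mulgA mulgV mul1g mulgK.
Qed.

Lemma invs_cat u v : invs (u ++ v) = invs u ++ invs_conj (word u) (invs v).
Proof.
elim: u => [|i u IHu] /=; first by rewrite word0 invs_conj1.
by rewrite IHu word_cons invs_conjM /invs_conj map_cat.
Qed.

Lemma size_invs u : size (invs u) = size u.
Proof. by elim: u => //= i u IHu; rewrite size_map IHu. Qed.

(* Since s_i inverts c = s_i s_j, the k-th reflection of (i j)^m is c^k s_i. *)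
Lemma invs_braid_word i j m :
  invs (flatten (nseq m [:: i; j])) =
  [seq (s_ i * s_ j) ^+ k * s_ i | k <- iota 0 m.*2].
Proof.
elim: m => // m IHm; rewrite doubleS [nseq _ _]/= [flatten _]/= [iota _ _]/=.
rewrite [LHS]/= IHm -/(invs_conj _ _) -invs_conjM.
rewrite !map_cons expg0 expg1 mul1g -[iota 2 _]/(iota (2 + 0) m.*2) iotaDl.
rewrite gen_inv; congr [:: _, _ & _].
rewrite -map_comp /invs_conj -map_comp; apply: eq_map => k.
rewrite [LHS]/= [RHS]/= invgM !gen_inv addnC expgD [_ ^+ 2]expgSr expg1.
rewrite !mulgA -[_ * _ ^+ k]expgS expgSr.
by rewrite !mulgA.
Qed.

Lemma braid_relation i j m : M i j = Some m -> (s_ i * s_ j) ^+ m = 1.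
Proof.
move=> Mij; transitivity (word (flatten (nseq m [:: i; j]))).
  by elim: {Mij} m => // m IHm; rewrite expgS IHm !word_cons mulgA.
rewrite -word0; apply/word_eq; rewrite -[flatten _]cats0.
exact: (@CoxRel _ _ [::] [::]).
Qed.

(** Inserting a relator preserves the parity: since (s_i s_j)^m = 1, the relator lists the same [m]
    reflections twice and does not move the reflections of the letters after it. *)
Lemma odd_count_invs u v t :
  word u = word v -> odd (count_mem t (invs u)) = odd (count_mem t (invs v)).
Proof.
move=> /word_eq uv; elim: uv t => {u v} // [u v i j m Mij t|u v w _ H1 _ H2 t].
  have R1 : word (flatten (nseq m [:: i; j])) = 1.
    rewrite -word0; apply/word_eq; rewrite -[flatten _]cats0.
    exact: (@CoxRel _ _ [::] [::]).
  rewrite !invs_cat R1 invs_conj1 /invs_conj map_cat !count_cat.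
  rewrite -!/(invs_conj _ _) count_invs_conj invs_braid_word -addnn iotaD map_cat.
  have -> : [seq (s_ i * s_ j) ^+ k * s_ i | k <- iota (0 + m) m] =
            [seq (s_ i * s_ j) ^+ k * s_ i | k <- iota 0 m].
    rewrite add0n -{1}[m]addn0 iotaDl -map_comp; apply: eq_map => k /=.
    by rewrite expgD (braid_relation Mij) mul1g.
  by rewrite count_cat addnn !oddD odd_double.
by rewrite H1 H2.
Qed.

(** A reflection listed once for [u] is listed an odd number of times, hence at least once, for a
    shortest word of the same element. *)
Lemma uniq_invs_length u : uniq (invs u) -> len (word u) = size u.
Proof.
move=> uu; have [v szv /esym uv] := length_witness (word u).
apply/eqP; rewrite eqn_leq length_le -szv -(size_invs u) -(size_invs v).
apply: uniq_leq_size => // t tu; rewrite -has_pred1 has_count.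
have := odd_count_invs t uv; rewrite (count_uniq_mem _ uu) tu.
by case: count.
Qed.

(** Strong exchange: multiplying by the reflection of a letter deletes that letter. *)
Lemma exchange u t :
  t \in invs u -> exists v,
    [/\ {subset v <= u}, (size v).+1 = size u & t * word u = word v].
Proof.
elim: u t => // i u IHu t; rewrite inE word_cons => /orP[/eqP ->|].
  exists u; split=> //; first by move=> j; rewrite inE orbC => ->.
  by rewrite mulgA gen_invol mul1g.
rewrite mem_invs_conj gen_inv => /IHu[v [vu szv tv]]; exists (i :: v); split.
- by move=> j; rewrite !inE => /orP[->//|/vu ->]; rewrite orbT.
- by rewrite /= szv.
- by rewrite word_cons -tv !mulgA gen_invol mul1g.
Qed.

(** If the reflection of the first letter recurs, exchange in the tail cancels the first letter
    against a later one. *)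
Lemma deletion u : ~~ uniq (invs u) -> exists v,
  [/\ {subset v <= u}, size v < size u & word v = word u].
Proof.
elim: u => // i u IHu; rewrite [invs _]/= cons_uniq negb_and negbK.
rewrite (map_inj_uniq (@invs_conj_inj _)) => /orP[|/IHu[v [vu szv uv]]].
  rewrite mem_invs_conj gen_inv gen_invol mul1g => /exchange[v [vu szv uv]].
  exists v; split; last by rewrite -uv word_cons.
    by move=> j /vu ju; rewrite inE ju orbT.
  by rewrite /= ltnS -szv leqnSn.
exists (i :: v); split; last by rewrite !word_cons uv.
  by move=> j; rewrite !inE => /orP[->//|/vu ->]; rewrite orbT.
by rewrite /= ltnS.
Qed.

(** Control of the letters provides elements of a parabolic subgroup with reduced words inside
    it. *)
Lemma reduced_word u : exists v,
  [/\ {subset v <= u}, uniq (invs v) & word v = word u].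
Proof.
have [n] := ubnP (size u); elim: n u => // n IHn u; rewrite ltnS => szu.
have [uu|/deletion[v [vu szv uv]]] := boolP (uniq (invs u)); first by exists u; split.
have [v' [v'v uv' v'E]] := IHn v (leq_trans szv szu).
exists v'; split=> //; first by move=> j /v'v/vu.
by rewrite v'E.
Qed.

End Words.

(** * Parabolic subgroups *)

Section Generated.
Variables (G : groupType) (A : set G).

Lemma generated_subset x : A x -> generated_subgroup A x.
Proof. by move=> Ax H [_ AH]; apply: AH. Qed.

Lemma generated1 : generated_subgroup A 1.
Proof. by move=> H [[H1 _] _]. Qed.

Lemma generatedM x y :
  generated_subgroup A x -> generated_subgroup A y ->
  generated_subgroup A (x * y).
Proof.
move=> Ax Ay H HA; have [[H1 HM] _] := HA.
rewrite -[y]invgK; apply: (HM _ _ (Ax H HA)); rewrite -[y^-1]mul1g.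
exact: HM (Ay H HA).
Qed.

(** For involutive generators the inverse of a product is the reversed product, so products without
    inverses already form a subgroup. *)
Lemma generated_invol_seq w :
  (forall x, A x -> x^-1 = x) -> generated_subgroup A w ->
  exists2 l : seq G, (forall x, x \in l -> A x) & w = \prod_(x <- l) x.
Proof.
pose H : set G := fun w =>
  exists2 l : seq G, (forall x, x \in l -> A x) & w = \prod_(x <- l) x.
move=> Ainv /(_ H); apply; split; first split.
- by exists [::]; rewrite ?big_nil.
- move=> _ _ [k kA ->] [l lA ->]; exists (k ++ rev l).
    by move=> x; rewrite mem_cat mem_rev => /orP[/kA|/lA].
  rewrite big_cat /=; congr (_ * _).
  elim: l lA => [|x l IHl] lA; first by rewrite !big_nil invg1.
  rewrite big_cons invgM rev_cons -cats1 big_cat /= IHl.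
    by rewrite big_seq1 (Ainv x) //; apply: lA; rewrite mem_head.
  by move=> y yl; apply: lA; rewrite inE yl orbT.
- by move=> x Ax; exists [:: x]; rewrite ?big_seq1 // => y; rewrite inE => /eqP ->.
Qed.

End Generated.

Fixpoint alt (T : Type) n (i j : T) : seq T :=
  if n is n'.+1 then i :: alt n' j i else [::].

Lemma size_alt (T : Type) n (i j : T) : size (alt n i j) = n.
Proof. by elim: n i j => //= n IHn i j; rewrite IHn. Qed.

Section Parabolic.
Variables (I : finType) (M : coxMatrix I).
Implicit Types (i j : I) (u v : seq I) (J : {set I}) (w x y t : coxgroup M).
Local Notation s_ := (@cox_gen I M).
Local Notation len := (@cox_length I M).

Lemma parabolicP J w :
  parabolic (M := M) J w <-> exists2 u, {subset u <= J} & word M u = w.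
Proof.
split=> [|[u uJ <-]].
  move/generated_invol_seq=> [x [i _ <-]|l lA ->]; first exact: gen_inv.
  elim: l lA => [|x l IHl] lA; first by exists [::]; rewrite ?big_nil.
  have [|u uJ uE] := IHl; first by move=> y yl; apply: lA; rewrite inE yl orbT.
  have [i iJ ix] := lA x (mem_head _ _); exists (i :: u).
    by move=> j; rewrite inE => /orP[/eqP ->|/uJ].
  by rewrite big_cons -ix -uE word_cons.
elim: u uJ => [|i u IHu] uJ; first exact: generated1.
rewrite word_cons; apply: generatedM.
  by apply: generated_subset; exists i => //; apply: uJ; rewrite mem_head.
by apply: IHu => j ju; apply: uJ; rewrite inE ju orbT.
Qed.

(** Finiteness bounds the lengths, so a maximum is attained and the choice in [longest] is not the
    default value. *)
Lemma longestP J : spherical M J ->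
  parabolic J (longest M J) /\
  forall x, parabolic J x -> len x <= len (longest M J).
Proof.
move=> /finite_seqP[s sE].
pose E n := `[< exists2 w, parabolic (M := M) J w & len w = n >].
have exE : exists n, E n.
  by exists (len 1); apply/asboolP; exists 1 => //; apply: generated1.
have leE n : E n -> n <= \max_(w <- s) len w.
  move=> /asboolP[w Jw <-]; have {Jw}: w \in s by move: Jw; rewrite sE.
  by move=> ws; apply: (leq_bigmax_seq (F := len)).
case: (ex_maxnP exE leE) => n /asboolP[w Jw wn] maxn.
apply: (@xgetPex _ 1 [set w | parabolic J w /\
  forall x, parabolic J x -> len x <= len w]%classic).
by exists w; split=> // x Jx; rewrite wn maxn //; apply/asboolP; exists x.
Qed.

Lemma word_alt_double i j m :
  word M (alt m.*2 i j) = (s_ i * s_ j) ^+ m.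
Proof.
by elim: m => // m IHm; rewrite doubleS /= !word_cons IHm expgS mulgA.
Qed.

Lemma alt_cat (T : Type) (i j : T) m n :
  alt (m + n) i j = alt m i j ++ (if odd m then alt n j i else alt n i j).
Proof. by elim: m i j => //= m IHm i j; rewrite IHm; case: odd. Qed.

Lemma rev_alt (T : Type) (i j : T) m :
  rev (alt m i j) = if odd m then alt m i j else alt m j i.
Proof.
elim: m i j => //= m IHm i j; rewrite rev_cons IHm -cats1.
have := alt_cat i j m 1; have := alt_cat j i m 1; rewrite !addn1 /=.
by case: odd => /= E1 E2; rewrite ?E1 ?E2.
Qed.

(** The second half of the relator of [m.*2] letters is [alt m j i] reversed, whatever the parity of
    [m], hence represents its inverse. *)
Lemma braid i j m : M i j = Some m -> word M (alt m i j) = word M (alt m j i).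
Proof.
move=> /braid_relation; rewrite -word_alt_double -addnn alt_cat wordM => E.
have := rev_alt i j m; have := rev_alt j i m; move: E; case: odd => /= E R1 R2.
  by rewrite -[in RHS]R1 word_rev; apply: (mulIg (word M (alt m j i))); rewrite E mulVg.
by rewrite -[in RHS]R2 word_rev; apply: (mulIg (word M (alt m i j))); rewrite E mulVg.
Qed.

(** Prepending a letter to an alternating word either extends it or cancels its first letter. *)
Lemma dihedral_words i j m u : M i j = Some m -> {subset u <= [set i; j]} ->
  exists k, k <= m /\ (word M u = word M (alt k i j) \/
                       word M u = word M (alt k j i)).
Proof.
move=> Mij; have m_gt0 : 0 < m.
  by case: m Mij => // Mij; case: (cox_m_neq0 Mij).
elim: u => [|k u IHu] uJ; first by exists 0; split=> //; left.
have [|n [nm un]] := IHu; first by move=> l lu; apply: uJ; rewrite inE lu orbT.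
have step a b : M a b = Some m ->
    word M u = word M (alt n a b) \/ word M u = word M (alt n b a) ->
  exists n', n' <= m /\ (word M (a :: u) = word M (alt n' a b) \/
                        word M (a :: u) = word M (alt n' b a)).
  move=> Mab {IHu uJ}un.
  have pos n' : n' < m -> word M u = word M (alt n'.+1 a b) ->
    exists n', n' <= m /\ (word M (a :: u) = word M (alt n' a b) \/
                        word M (a :: u) = word M (alt n' b a)).
    move=> n'm uE; exists n'; split; first exact: ltnW.
    by right; rewrite word_cons uE word_cons mulgA gen_invol mul1g.
  (* At [m] letters both alternating words represent the same element, so the one starting with [a]
     may be taken and [a] cancels. *)
  move: nm; rewrite leq_eqVlt => /orP[/eqP nE|ltnm].
    have uE : word M u = word M (alt m a b).
      by move: un; rewrite nE (braid Mab) => -[].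
    by apply: (pos m.-1); rewrite ?prednK.
  case: un => [uE|uE].
    case: n ltnm uE => [|n] ltnm uE; last by apply: (pos n) => //; apply: ltnW.
    by exists 1%N; split=> //; left; rewrite !word_cons uE.
  by exists n.+1; split=> //; left; rewrite /= !word_cons uE.
have := uJ k (mem_head _ _); rewrite !inE => /orP[/eqP ->|/eqP ->].
  exact: step.
have Mji : M j i = Some m by rewrite cox_m_sym.
have [n' [n'm n'E]] := step j i Mji (iffLR (or_comm _ _) un).
by exists n'; split=> //; case: n'E; auto.
Qed.

(** Every element is an alternating word with at most [m] letters, and both words with [m] letters
    agree. Taking [i = j] and [m = 1] covers singletons. *)
Lemma longest_dihedral i j m J :
  M i j = Some m -> J = [set i; j]%SET -> len (word M (alt m i j)) = m ->
  spherical M J /\ longest M J = word M (alt m i j).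
Proof.
move=> Mij -> lenm; have sph : spherical M [set i; j].
  pose s := [seq word M (alt k i j) | k <- iota 0 m.+1] ++
            [seq word M (alt k j i) | k <- iota 0 m.+1].
  apply: (@sub_finite_set _ _ [set` s]); last exact: finite_seq.
  move=> w /parabolicP[u uJ <-]; have [k [km uE]] := dihedral_words Mij uJ.
  suff : word M u \in s by [].
  rewrite mem_cat; apply/orP; case: uE => ->; [left|right];
    by apply/mapP; exists k; rewrite ?mem_iota.
split=> //; have [/parabolicP[u uJ uE] maxl] := longestP sph.
have Jalt : parabolic [set i; j]%SET (word M (alt m i j)).
  apply/parabolicP; exists (alt m i j) => // k.
  elim: (m) (i) (j) => //= n IHn a b; rewrite inE => /orP[/eqP ->|/IHn].
    by rewrite !inE eqxx.
  by rewrite !inE orbC.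
have := maxl _ Jalt; rewrite lenm -uE; have [k [km E]] := dihedral_words Mij uJ.
move=> lem; have k_eq : k = m.
  apply/eqP; rewrite eqn_leq km (leq_trans lem) //.
  by case: E => ->; rewrite (leq_trans (length_le _ _)) ?size_alt.
by move: E; rewrite k_eq (braid Mij) => -[].
Qed.

End Parabolic.

(** * Admissibility criteria *)

(** Built from the right: a nonempty product ends in [x], which decides its right descents. [altsum]
    adds up lengths in the same pattern. *)
Fixpoint altprod (G : groupType) k (x y : G) : G :=
  if k is k'.+1 then altprod k' y x * x else 1.

Fixpoint altsum k (a b : nat) : nat :=
  if k is k'.+1 then altsum k' b a + a else 0.

Lemma altprodD (G : groupType) p k (x y : G) : altprod (p + k) x y =
  (if odd k then altprod p y x else altprod p x y) * altprod k x y.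
Proof.
elim: k x y => [|k IHk] x y; first by rewrite addn0 mulg1.
by rewrite addnS /= IHk mulgA; case: odd.
Qed.

Lemma altsumD p k a b : altsum (p + k) a b =
  (if odd k then altsum p b a else altsum p a b) + altsum k a b.
Proof.
elim: k a b => [|k IHk] a b; first by rewrite addn0 addn0.
by rewrite addnS /= IHk addnA; case: odd.
Qed.

Lemma altprod_double (G : groupType) n (x y : G) :
  altprod n.*2 x y = (y * x) ^+ n.
Proof. by elim: n => //= n IHn; rewrite IHn expgSr mulgA. Qed.

Lemma altsum_double n a b : altsum n.*2 a b = (n * (a + b))%N.
Proof. by elim: n => //= n ->; rewrite mulSn; lia. Qed.

Section Admissibility.
Variables (I : finType) (M : coxMatrix I).
Implicit Types (i j a b c : I) (u v : seq I) (J K : {set I}).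
Implicit Types (P : {set {set I}}) (w x y t : coxgroup M).
Local Notation s_ := (@cox_gen I M).
Local Notation len := (@cox_length I M).
Local Notation dihedral P :=
  (generated_subgroup ((@longest I M) @` [set` P])%classic).

Lemma lengthV w : len w^-1 = len w.
Proof.
suff le x : len x^-1 <= len x by apply/eqP; rewrite eqn_leq le -{1}[w]invgK le.
by have [u <- <-] := length_witness x; rewrite -word_rev -size_rev length_le.
Qed.

Lemma longest_desc J i : spherical M J -> i \in J ->
  len (longest M J * s_ i) < len (longest M J).
Proof.
move=> /longestP[Jx maxx] iJ.
have {maxx}: len (longest M J * s_ i) <= len (longest M J).
  by apply: maxx; apply: generatedM => //; apply: generated_subset; exists i.
by have [->|->] := length_genr_cases (longest M J) i; rewrite ?ltnn ?leqnn.
Qed.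

Lemma length_desc w x i : len (w * x) = (len w + len x)%N ->
  len (x * s_ i) < len x -> len (w * x) = (len (w * x * s_ i)).+1.
Proof.
move=> E xi; have [E'|//] := length_genr_cases (w * x) i.
by have := lengthM w (x * s_ i); rewrite mulgA E' E; lia.
Qed.

(** As [x] is an involution, s_i is also a left descent of it. If s_i shortened [w] too, splitting w
    x as (w s_i)(s_i x) would contradict additivity. *)
Lemma length_asc w x i : x * x = 1 -> len (w * x) = (len w + len x)%N ->
  len (x * s_ i) < len x -> len (w * s_ i) = (len w).+1.
Proof.
move=> xx E xi; have [//|E'] := length_genr_cases w i.
have := lengthM (w * s_ i) (s_ i * x).
rewrite -mulgA (mulgA (s_ i)) gen_invol mul1g E.
have -> : len (s_ i * x) = len (x * s_ i).
  by rewrite -lengthV invgM gen_inv -(mulg1 x^-1) -xx mulKg.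
by lia.
Qed.

Section Alternating.
Variables (x y : coxgroup M) (n : nat).
Hypotheses (xx : x * x = 1) (yy : y * y = 1).
Hypothesis len_full : len (altprod n x y) = altsum n (len x) (len y).

Lemma length_altprod_le k (x' y' : coxgroup M) :
  len (altprod k x' y') <= altsum k (len x') (len y').
Proof.
elim: k x' y' => [|k IHk] x' y' /=; first by rewrite length1.
by rewrite (leq_trans (lengthM _ _)) // leq_add2r.
Qed.

(** Lengths are subadditive, so additivity for the product of [n] factors forces it for every final
    segment. *)
Lemma length_altprod k : k <= n ->
  len (altprod k x y) = altsum k (len x) (len y).
Proof.
move=> kn; apply/eqP; rewrite eqn_leq length_altprod_le /=.
move: len_full; rewrite -(subnK kn) altprodD altsumD => E.
have := lengthM (if odd k then altprod (n - k) y x else altprod (n - k) x y)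
                (altprod k x y).
rewrite E; have := length_altprod_le (n - k) x y.
have := length_altprod_le (n - k) y x.
by case: odd; lia.
Qed.

Lemma length_altprodS k : k < n ->
  len (altprod k y x * x) = (len (altprod k y x) + len x)%N.
Proof.
move=> kn; have := length_altprod kn; rewrite /= => E.
apply/eqP; rewrite eqn_leq lengthM [leqRHS]E leq_add2r.
exact: length_altprod_le.
Qed.

Lemma altprod_desc k i : 0 < k <= n -> len (x * s_ i) < len x ->
  len (altprod k x y) = (len (altprod k x y * s_ i)).+1.
Proof. by case: k => // k /= kn; apply/length_desc/length_altprodS. Qed.

Lemma altprod_asc k i : k < n -> len (x * s_ i) < len x ->
  len (altprod k y x * s_ i) = (len (altprod k y x)).+1.
Proof. by move=> kn; apply/length_asc/length_altprodS. Qed.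

End Alternating.

Lemma alternating_admissible J K n :
  let x := longest M J in let y := longest M K in
  two_partition [set J; K] -> spherical M J -> spherical M K -> 0 < n ->
  x * x = 1 -> y * y = 1 -> (x * y) ^+ n = (y * x) ^+ n ->
  len ((x * y) ^+ n) = (n * (len x + len y))%N -> admissible M [set J; K].
Proof.
move=> x y P2 sJ sK n_gt0 xx yy xyn len_n; split=> //.
  by move=> L; rewrite !inE => /orP[] /eqP ->.
have full : len (altprod n.*2 x y) = altsum n.*2 (len x) (len y).
  by rewrite altprod_double altsum_double -xyn.
have full' : len (altprod n.*2 y x) = altsum n.*2 (len y) (len x).
  by rewrite altprod_double altsum_double addnC.
have eq2n : altprod n.*2 x y = altprod n.*2 y x by rewrite !altprod_double.
have n2_gt0 : 0 < n.*2 by rewrite double_gt0.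
pose form w k (z z' : coxgroup M) := k <= n.*2 /\ w = altprod k z z'.
have xV : x^-1 = x by rewrite -[x^-1]mulg1 -xx mulKg.
have yV : y^-1 = y by rewrite -[y^-1]mulg1 -yy mulKg.
have mem2 L : [set` [set J; K]%SET]%classic L -> L = J \/ L = K.
  move=> LP; have : L \in [set J; K] by [].
  by rewrite !inE => /orP[] /eqP; auto.
(* Multiplying by a generator adds or cancels a factor; with [n.*2] factors the two products agree,
   so a factor can always be cancelled there. *)
have formP w : dihedral [set J; K]%SET w ->
    exists k, form w k x y \/ form w k y x.
  move/generated_invol_seq => [z [L LP <-]|l lP ->].
    by case: (mem2 L LP) => ->.
  elim/last_ind: l lP => [|l z IHl] lP.
    by exists 0; rewrite big_nil; left.
  rewrite big_rcons /=; have [|k kP] := IHl.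
    by move=> t tl; apply: lP; rewrite mem_rcons inE tl orbT.
  have {lP IHl} : z = x \/ z = y.
    have [|L LP <-] := lP z; first by rewrite mem_rcons mem_head.
    by case: (mem2 L LP) => ->; [left|right].
  move: (\prod_(i <- l) i) kP => {}w.
  have step x' y' : x' * x' = 1 -> altprod n.*2 x' y' = altprod n.*2 y' x' ->
      form w k x' y' \/ form w k y' x' ->
      exists k, form (w * x') k x' y' \/ form (w * x') k y' x'.
    have back k0 : x' * x' = 1 -> k0.+1 <= n.*2 -> w = altprod k0.+1 x' y' ->
        exists k, form (w * x') k x' y' \/ form (w * x') k y' x'.
      move=> xx' kn ->; exists k0; right; split; first exact: ltnW.
      by rewrite /= -mulgA xx' mulg1.
    move=> xx' eq' [[kn wE]|[kn wE]].
      case: k kn wE => [|k] kn wE; last exact: (back k).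
      by exists 1%N; left; split=> //; rewrite wE.
    move: kn; rewrite leq_eqVlt => /orP[/eqP kE|kn].
      by apply: (back n.*2.-1) => //; rewrite prednK // wE kE -eq'.
    by exists k.+1; left; split=> //; rewrite wE.
  move=> kP [->|->]; first exact: step.
  by have [k' [?|?]] := step _ _ yy (esym eq2n) (iffLR (or_comm _ _) kP);
    exists k'; [right|left].
have cond w k x' y' J' K' :
    x' * x' = 1 -> y' * y' = 1 ->
    len (altprod n.*2 x' y') = altsum n.*2 (len x') (len y') ->
    len (altprod n.*2 y' x') = altsum n.*2 (len y') (len x') ->
    altprod n.*2 x' y' = altprod n.*2 y' x' ->
    (forall i, i \in J' -> len (x' * s_ i) < len x') ->
    (forall i, i \in K' -> len (y' * s_ i) < len y') ->
    form w k x' y' -> forall L, L \in [set J'; K'] ->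
    (forall i, i \in L -> len (w * s_ i) = (len w).+1) \/
    (forall i, i \in L -> len w = (len (w * s_ i)).+1).
  move=> xx' yy' full1 full2 eq' Jx Ky [kn ->] L; rewrite !inE.
  move=> /orP[] /eqP -> {L}.
    (* For the part of the last factor, the empty product goes up and every other one goes down. *)
    case: k kn => [|k] kn; first left => i iJ.
      exact: (altprod_asc (x := x') (y := y') xx' full1 (k := 0) n2_gt0 (Jx i iJ)).
    by right=> i iJ; apply: (altprod_desc full1) => //; apply: Jx.
  (* For the other part, the full product also ends in [y'] and goes down; a shorter one can still
     be extended by [y'] and goes up. *)
  move: kn; rewrite leq_eqVlt => /orP[/eqP -> {k}|kn].
    rewrite eq'; right=> i iK; apply: (altprod_desc full2); last exact: Ky.
    by rewrite n2_gt0 leqnn.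
  by left=> i iK; apply: (altprod_asc yy' full2 kn); apply: Ky.
have Jx i : i \in J -> len (x * s_ i) < len x by apply: longest_desc.
have Ky i : i \in K -> len (y * s_ i) < len y by apply: longest_desc.
move=> w /formP[k [wk|wk]]; first exact: (cond w k x y).
by rewrite finset.setUC; apply: (cond w k y x).
Qed.

Lemma mixed_not_admissible P J w b c : J \in P -> dihedral P w ->
  b \in J -> c \in J -> len w < len (w * s_ b) -> len (w * s_ c) <= len w ->
  ~ admissible M P.
Proof.
move=> JP Pw bJ cJ wb wc [_ _ /(_ w Pw J JP)[/(_ c cJ) E|/(_ b bJ) E]].
  by move: wc; rewrite E ltnn.
by move: wb; rewrite E ltnNge leqnSn.
Qed.

Lemma commuting_gens i j : M i j = Some 2 -> s_ i * s_ j = s_ j * s_ i.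
Proof. by move/braid; rewrite !word_cons word0 !mulg1. Qed.

Lemma commuting_word c v : (forall a, a \in v -> M c a = Some 2) ->
  s_ c * word M v = word M v * s_ c.
Proof.
elim: v => [|a v IHv] cv; first by rewrite mulg1 mul1g.
rewrite word_cons mulgA (@commuting_gens c a) ?cv ?mem_head // -!mulgA.
by rewrite IHv // => a' av; apply: cv; rewrite inE av orbT.
Qed.

(** By exchange, [t] is a quotient of two words in the letters of [u]. *)
Lemma invs_parabolic J u t : {subset u <= J} -> t \in invs M u -> parabolic J t.
Proof.
move=> uJ /exchange[v [vu _ tE]]; apply/parabolicP; exists (v ++ rev u).
  by move=> i; rewrite mem_cat mem_rev => /orP[/vu/uJ|/uJ].
by rewrite wordM word_rev -tE mulgK.
Qed.

(* The reflections of r_K followed by those of v and b are pairwise distinct,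
   so r_K r_J s_b is longer than r_K r_J; but s_c commutes with r_J and cancels
   against r_K. *)
Lemma commuting_not_admissible P J K v b c :
  J \in P -> K \in P -> longest M J = word M v -> b \in K -> c \in K ->
  (forall a, a \in v -> M c a = Some 2) -> uniq (invs M (rcons v b)) ->
  (forall t, t \in invs M (rcons v b) -> ~ parabolic K t) ->
  ~ admissible M P.
Proof.
move=> JP KP Jv bK cK cv uvb vbK admP; have [_ sph _] := admP.
have [/parabolicP[u0 u0K u0E] maxK] := longestP (sph K KP).
have [u [uu0 uu uE]] := reduced_word M u0; rewrite u0E in uE.
have uK : {subset u <= K} by move=> i /uu0/u0K.
have uniq_uvb : uniq (invs M ((u ++ v) ++ [:: b])).
  rewrite -catA cats1 invs_cat cat_uniq uu (map_inj_uniq (@invs_conj_inj _ _ _)).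
  rewrite uvb andbT; apply/hasPn => t; rewrite mem_invs_conj => tvb.
  apply/negP => tu; apply: (vbK _ tvb).
  have Kt := invs_parabolic uK tu; have Ku : parabolic K (word M u).
    by apply/parabolicP; exists u.
  have KuV : parabolic K (word M u)^-1.
    apply/parabolicP; exists (rev u); last exact: word_rev.
    by move=> i; rewrite mem_rev => /uK.
  by apply: generatedM => //; apply: generatedM.
have len_uvb := uniq_invs_length uniq_uvb.
have len_uv : len (word M (u ++ v)) = size (u ++ v).
  apply: uniq_invs_length.
  by move: uniq_uvb; rewrite invs_cat cat_uniq => /andP[].
apply: (mixed_not_admissible KP _ bK cK) admP.
- apply: (generatedM (x := longest M K) (y := longest M J));
    apply: generated_subset; [by exists K|by exists J].
- by rewrite Jv -uE -wordM -(wordM _ _ [:: b]) len_uvb len_uv !size_cat addn1.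
- rewrite -mulgA Jv -commuting_word // mulgA -uE -(wordM M u v) len_uv size_cat.
  rewrite (leq_trans (lengthM _ _)) // leq_add ?length_le //.
  rewrite -(uniq_invs_length uu) uE ltnW // longest_desc //; exact: sph.
Qed.

End Admissibility.

(** * Actions of Coxeter groups as computable models *)

Section Model.
Variables (I : finType) (M : coxMatrix I) (X Y : eqType).
Variables (act : I -> X -> X) (coord : I -> X -> Y).

Definition run u x := foldr act x u.

(** Given involutivity, the braid form of the relations is equivalent to (s_i s_j)^m = 1. *)
Definition is_model := (forall i x, act i (act i x) = x) /\
  forall i j m, M i j = Some m ->
  forall x, run (alt m i j) x = run (alt m j i) x.

Definition local_action := forall i j x, i != j -> coord i (act j x) = coord i x.

(** Words for the reflections in [invs u]: unlike classes in the quotient, they can be run on a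
    concrete point. *)
Fixpoint refl_words (u : seq I) : seq (seq I) :=
  if u is i :: u' then [:: i] :: [seq i :: rcons t i | t <- refl_words u']
  else [::].

Lemma invsE u : invs M u = [seq word M t | t <- refl_words u].
Proof.
elim: u => //= i u ->; congr (_ :: _); rewrite /invs_conj -!map_comp.
apply: eq_map => t /=.
by rewrite word_cons -cats1 wordM gen_inv mulgA.
Qed.

Hypothesis actM : is_model.

Lemma run_cat u v x : run (u ++ v) x = run u (run v x).
Proof. exact: foldr_cat. Qed.

Lemma run_revK u x : run u (run (rev u) x) = x.
Proof.
elim: u x => //= i u IHu x; have [actK _] := actM.
by rewrite rev_cons -cats1 run_cat IHu /= actK.
Qed.

Lemma run_braid i j m x : M i j = Some m ->
  run (flatten (nseq m [:: i; j])) x = x.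
Proof.
have altE n : flatten (nseq n [:: i; j]) = alt n.*2 i j.
  by elim: n => //= n ->.
have [_ br] := actM; move=> Mij; rewrite altE -addnn alt_cat run_cat.
rewrite -[RHS](run_revK (alt m i j)) rev_alt; congr run.
by case: odd; rewrite (br _ _ _ Mij).
Qed.

Lemma run_word u v x : word M u = word M v -> run u x = run v x.
Proof.
move=> /word_eq uv; elim: uv x => {u v} [u v i j m Mij x|//|u v _ IH x|v u w _ IH1 _ IH2 x].
- by rewrite !run_cat run_braid.
- by rewrite IH.
- by rewrite IH1.
Qed.

(** Reflections that move one point to different places are different, so a single computation
    proves a word reduced. *)
Lemma model_uniq x u :
  uniq [seq run t x | t <- refl_words u] -> uniq (invs M u).
Proof.
pose f w := run (repr (w : coxgroup M)) x => uu.
apply: (@map_uniq _ _ f); rewrite invsE -map_comp.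
congr uniq: uu; apply: eq_map => t; apply: run_word; rewrite /word reprK.
by [].
Qed.

(** Generators from [J] leave the coordinate at [a] unchanged when [a] is outside [J]. *)
Lemma model_not_parabolic (J : {set I}) x a t :
  local_action -> a \notin J -> coord a (run t x) != coord a x ->
  ~ parabolic J (word M t).
Proof.
move=> loc aJ /eqP tx /parabolicP[u uJ /run_word ut]; apply: tx; rewrite -ut.
elim: u uJ {ut} => //= i u IHu uJ; rewrite loc.
  by apply: IHu => j ju; apply: uJ; rewrite inE ju orbT.
by apply: contraNneq aJ => ->; apply: uJ; rewrite mem_head.
Qed.

End Model.

(** * Equality of words by braid moves *)

Section Braiding.
Variables (I : finType) (M : coxMatrix I).

Definition braid_move i j (u : seq I) :=
  if M i j is Some m then
    if take m u == alt m i j then alt m j i ++ drop m u else u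
  else u.

(** Rewrites [u] so as to start with [v], where [f j] tries to bring [j] to the front. Whatever
    letter comes first is kept, so the element is preserved even when [f] fails. *)
Fixpoint gather (f : I -> seq I -> seq I) (v u : seq I) :=
  if v is j :: v' then
    if f j u is i :: u' then i :: gather f v' u' else [::]
  else u.

(* If j is a left descent of a reduced word i :: u, then so is i, and the
   element has a reduced word starting with i j i ... (M i j letters). *)
Fixpoint to_front n (j : I) (u : seq I) :=
  if n is n'.+1 then
    if u is i :: u' then
      if i == j then u else if M i j is Some m then
        braid_move i j (i :: gather (to_front n') (behead (alt m i j)) u')
      else u
    else u
  else u.

Lemma word_braid_move i j u : word M (braid_move i j u) = word M u.
Proof.
rewrite /braid_move; case Mij: (M i j) => [m|//]; case: eqP => // um.
by rewrite -[in RHS](cat_take_drop m u) um !wordM (braid Mij).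
Qed.

Lemma word_gather f v u : (forall j u', word M (f j u') = word M u') ->
  word M (gather f v u) = word M u.
Proof.
move=> fM; elim: v u => //= j v IHv u; rewrite -[RHS](fM j).
by case: (f j u) => // i u'; rewrite !word_cons IHv.
Qed.

Lemma word_to_front n j u : word M (to_front n j u) = word M u.
Proof.
elim: n j u => //= n IHn j [|i u] //; case: eqP => // _.
case: (M i j) => // m; rewrite word_braid_move !word_cons; congr (_ * _).
exact: word_gather.
Qed.

(** Only soundness of the rewriting is needed: its success is checked by evaluating the premise. *)
Lemma gather_word u v : gather (to_front (size u)) v u = v -> word M u = word M v.
Proof. by move=> <-; rewrite word_gather // => j w; apply: word_to_front. Qed.

End Braiding.

(** * Geometric representations *)

(* Reflections of the root lattice: s_k changes only the k-th coordinate of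
   a b c d in the basis of simple roots. *)
Definition F4_act (k : nat) (x : Z * Z * Z * Z) : Z * Z * Z * Z :=
  let: (a, b, c, d) := x in
  match k with
  | 0%N => (b - a, b, c, d)
  | 1%N => (a, a + (c + c) - b, c, d)
  | 2%N => (a, b, b + d - c, d)
  | _ => (a, b, c, c - d)
  end%Z.

Definition F4_coord (k : nat) (x : Z * Z * Z * Z) : Z :=
  let: (a, b, c, d) := x in nth a [:: a; b; c; d] k.

(* Root lattice of H4 over Z[phi]; the pair (a, a') stands for a + a' phi, and
   the sublattice with last coordinate 0 is that of H3. *)
Notation Zphi4 := ((Z * Z) * (Z * Z) * (Z * Z) * (Z * Z))%type.

Definition H4_act (k : nat) (x : Zphi4) : Zphi4 :=
  let: ((a, a'), (b, b'), (c, c'), (d, d')) := x in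
  match k with
  | 0%N => ((b' - a, b + b' - a'), (b, b'), (c, c'), (d, d'))
  | 1%N => ((a, a'), (a' + c - b, a + a' + c' - b'), (c, c'), (d, d'))
  | 2%N => ((a, a'), (b, b'), (b + d - c, b' + d' - c'), (d, d'))
  | _ => ((a, a'), (b, b'), (c, c'), (c - d, c' - d'))
  end%Z.

Definition H4_coord (k : nat) (x : Zphi4) : Z * Z :=
  let: (a, b, c, d) := x in nth a [:: a; b; c; d] k.

(** The coefficients 2 and 1 between the middle coordinates have product 4 cos(pi/4)^2, which gives
    the label 4. *)
Lemma F4_model : is_model cox_F4 (fun i => F4_act i).
Proof.
split=> [[[|[|[|[|//]]]] ?] [[[a b] c] d]|
    [[|[|[|[|//]]]] ?] [[|[|[|[|//]]]] ?] m [<-] [[[a b] c] d]];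
  rewrite /F4_act /=; congr (_, _, _, _); apply: (id (_ : _ = _ :> Z)); ring.
Qed.

Lemma F4_local : local_action (fun i : 'I_4 => F4_act i) (fun i => F4_coord i).
Proof.
by move=> [[|[|[|[|//]]]] ?] [[|[|[|[|//]]]] ?] [[[a b] c] d].
Qed.

(** Multiplication by phi sends [(b, b')] to [(b', b + b')], since phi^2 = phi + 1; the label 5
    comes from phi = 2 cos(pi/5). *)
Lemma H4_model : is_model cox_H4 (fun i => H4_act i).
Proof.
split=> [[[|[|[|[|//]]]] ?] [[[[a a'] [b b']] [c c']] [d d']]|
    [[|[|[|[|//]]]] ?] [[|[|[|[|//]]]] ?] m [<-] [[[[a a'] [b b']] [c c']] [d d']]];
  rewrite /H4_act /=; congr ((_, _), (_, _), (_, _), (_, _)); apply: (id (_ : _ = _ :> Z)); ring.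
Qed.

Lemma H4_local : local_action (fun i : 'I_4 => H4_act i) (fun i => H4_coord i).
Proof.
by move=> [[|[|[|[|//]]]] ?] [[|[|[|[|//]]]] ?] [[[[a a'] [b b']] [c c']] [d d']].
Qed.

Lemma H3_model : is_model cox_H3 (fun i => H4_act i).
Proof.
split=> [[[|[|[|//]]] ?] [[[[a a'] [b b']] [c c']] [d d']]|
    [[|[|[|//]]] ?] [[|[|[|//]]] ?] m [<-] [[[[a a'] [b b']] [c c']] [d d']]];
  rewrite /H4_act /=; congr ((_, _), (_, _), (_, _), (_, _)); apply: (id (_ : _ = _ :> Z)); ring.
Qed.

Lemma H3_local : local_action (fun i : 'I_3 => H4_act i) (fun i => H4_coord i).
Proof.
by move=> [[|[|[|//]]] ?] [[|[|[|//]]] ?] [[[[a a'] [b b']] [c c']] [d d']].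
Qed.

(** * Two-partitions *)

(** Choosing the part that contains [i] breaks the symmetry: case analysis then runs over the other
    vertices only. *)
Lemma two_partition_compl (I : finType) (i : I) (P : {set {set I}}) :
  two_partition P ->
  exists J : {set I}, [/\ i \in J, J != [set: I]%SET & P = [set J; ~: J]%SET].
Proof.
move=> [/and3P[/eqP covP trivP P0] /eqP/cards2P[A [B [AB PE]]]].
have AP : A \in P by rewrite PE !inE eqxx.
have BP : B \in P by rewrite PE !inE eqxx orbT.
have BE : B = ~: A.
  apply/eqP; rewrite finset.eqEsubset -finset.disjoints_subset disjoint_sym.
  rewrite (finset.trivIsetP trivP _ _ AP BP AB) /=; apply/fintype.subsetP => x.
  have : x \in finset.cover P by rewrite covP inE.
  case/finset.bigcupP=> C; rewrite PE !inE => /orP[] /eqP -> // xA.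
  by rewrite xA.
have [iA|iA] := boolP (i \in A).
  exists A; split=> //; last by rewrite PE BE.
  by apply: contraNneq P0 => AT; rewrite -finset.setCT -AT -BE.
exists B; split; first by rewrite BE inE.
  apply: contraNneq P0 => BT; suff <- : A = finset.set0 by [].
  by rewrite -(finset.setCK A) -BE BT finset.setCT.
by rewrite PE BE finset.setCK finset.setUC.
Qed.

Lemma two_partition_setC (I : finType) (J : {set I}) :
  J != finset.set0 -> J != [set: I]%SET -> two_partition [set J; ~: J]%SET.
Proof.
move=> J0 JT; have JC : J != ~: J.
  apply: contra_neq J0 => JC; apply/setP => x; rewrite inE.
  by have := erefl (x \in J); rewrite {1}JC inE; case: (x \in J).
split; last by rewrite cards2 JC.
apply/and3P; split.
- by rewrite /finset.cover finset.bigcup_setU !big_set1 finset.setUCr.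
- apply/finset.trivIsetP => A B; rewrite !inE.
  by move=> /orP[] /eqP -> /orP[] /eqP -> //; rewrite ?eqxx // => _;
    rewrite -finset.setI_eq0 ?finset.setICr // finset.setIC finset.setICr.
- by rewrite !inE eq_sym (negbTE J0) eq_sym -(inj_eq (can_inj (@finset.setCK I))) finset.setCK finset.setC0.
Qed.

(** * Criteria verified by evaluation *)

Section Concrete.
Variables (I : finType) (M : coxMatrix I) (X Y : eqType).
Variables (act : I -> X -> X) (coord : I -> X -> Y) (x0 : X).
Hypotheses (actM : is_model M act) (coord_act : local_action act coord).
Implicit Types (i j b c : I) (u v : seq I) (J K : {set I}).
Implicit Types (P : {set {set I}}).
Local Notation len := (@cox_length I M).

Definition distinct_images u := uniq [seq run act t x0 | t <- refl_words u].

Lemma uniq_invs_cat u v : uniq (invs M (u ++ v)) ->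
  uniq (invs M u) /\ uniq (invs M v).
Proof.
rewrite invs_cat cat_uniq (map_inj_uniq (@invs_conj_inj _ _ _)).
by case/and3P.
Qed.

Lemma word_alt_invol i j m : M i j = Some m ->
  word M (alt m i j) * word M (alt m i j) = 1.
Proof.
move=> Mij; suff aV : (word M (alt m i j))^-1 = word M (alt m i j).
  by rewrite -{1}aV mulVg.
by rewrite -word_rev rev_alt; case: odd; rewrite // (braid Mij).
Qed.

Lemma word_flatten_nseq n u : word M (flatten (nseq n u)) = word M u ^+ n.
Proof. by elim: n => // n IHn; rewrite /= wordM IHn expgS. Qed.

Lemma size_flatten_nseq n u : size (flatten (nseq n u)) = (n * size u)%N.
Proof. by elim: n => // n IHn; rewrite /= size_cat IHn mulSn. Qed.

(** Reduces [alternating_admissible] to evaluation: the images show that [un] is reduced, and braid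
    moves turn it into [vn]. *)
Lemma dihedral_pair_admissible i j m k l m' n :
  let u := alt m i j ++ alt m' k l in let v := alt m' k l ++ alt m i j in
  let un := flatten (nseq n u) in let vn := flatten (nseq n v) in
  two_partition [set [set i; j]; [set k; l]]%SET ->
  M i j = Some m -> M k l = Some m' -> 0 < n -> distinct_images un ->
  gather (to_front M (size un)) vn un = vn ->
  admissible M [set [set i; j]; [set k; l]].
Proof.
move=> u v un vn P2 Mij Mkl n_gt0 /(model_uniq actM) uniq_un /gather_word unvn.
(* Factors of a reduced word are reduced, which identifies the longest elements of both parts. *)
have [uniq_ij uniq_kl] : uniq (invs M (alt m i j)) /\ uniq (invs M (alt m' k l)).
  apply: uniq_invs_cat; move: uniq_un; rewrite /un; case: (n) n_gt0 => // n' _.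
  by move/uniq_invs_cat => [].
have := uniq_invs_length uniq_ij; rewrite size_alt => len_ij.
have := uniq_invs_length uniq_kl; rewrite size_alt => len_kl.
have [sph_ij long_ij] := longest_dihedral Mij erefl len_ij.
have [sph_kl long_kl] := longest_dihedral Mkl erefl len_kl.
apply: (alternating_admissible P2 sph_ij sph_kl n_gt0);
  rewrite ?long_ij ?long_kl ?(word_alt_invol Mij) ?(word_alt_invol Mkl) //.
  by rewrite -!(wordM M) -!word_flatten_nseq.
rewrite -(wordM M) -word_flatten_nseq len_ij len_kl (uniq_invs_length uniq_un).
by rewrite size_flatten_nseq size_cat !size_alt.
Qed.

(** A reflection that changes the coordinate at [i] or [j] is outside W_K, so evaluation at [x0]
    supplies the hypotheses of [commuting_not_admissible]. *)
Lemma separated_not_admissible P J K i j m b c :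
  let w := rcons (alt m i j) b in
  J \in P -> K \in P -> J = [set i; j]%SET -> M i j = Some m ->
  b \in K -> c \in K -> i \notin K -> j \notin K ->
  M c i = Some 2 -> M c j = Some 2 -> distinct_images w ->
  all (fun t => (coord i (run act t x0) != coord i x0) ||
                (coord j (run act t x0) != coord j x0)) (refl_words w) ->
  ~ admissible M P.
Proof.
move=> w JP KP JE Mij bK cK iK jK Mci Mcj /(model_uniq actM) uniq_w /allP sep.
have [uniq_ij _] : uniq (invs M (alt m i j)) /\ uniq (invs M [:: b]).
  by apply: uniq_invs_cat; rewrite cats1.
have := uniq_invs_length uniq_ij; rewrite size_alt => len_ij.
have [_ long_ij] := longest_dihedral Mij JE len_ij.
apply: (commuting_not_admissible JP KP long_ij bK cK _ uniq_w).
  elim: (m) (i) (j) Mci Mcj => //= n IHn a a' Ma Ma' d.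
  by rewrite inE => /orP[/eqP -> //|]; apply: IHn.
move=> t; rewrite invsE => /mapP[t' t'w ->].
by case/orP: (sep t' t'w); apply: model_not_parabolic.
Qed.

End Concrete.

(** A single generator always changes the length by exactly one, and a one-element part imposes
    nothing more. *)
Lemma singletons_admissible (I : finType) (M : coxMatrix I) (P : {set {set I}}) :
  two_partition P -> (forall J, J \in P -> exists i, J = [set i]%SET) ->
  admissible M P.
Proof.
move=> P2 P1; split=> // [J /P1[i ->]|w _ J /P1[i ->]].
  have Mii : M i i = Some 1%N by apply/cox_m_eq1.
  apply: (longest_dihedral Mii _ _).1; first by rewrite finset.setUid.
  exact: (@uniq_invs_length _ M [:: i]).
have [E|E] := length_genr_cases w i; [left|right] => j; rewrite inE => /eqP ->;
  exact: E.
Qed.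

(** * The types F4, H3, H4 and I2 *)

(* Unlike inord, this reduces to a canonical form. *)
Definition vtx n k : 'I_n.+1 := Ordinal (ltn_pmod k (ltn0Sn n)).

Lemma eq_vtx_set n (A B : {set 'I_n.+1}) :
  (forall k, k < n.+1 -> (vtx n k \in A) = (vtx n k \in B)) -> A = B.
Proof.
move=> AB; apply/setP => x; have := AB x (ltn_ord x).
by have -> : vtx n x = x by apply: val_inj; rewrite /= modn_small.
Qed.

Local Ltac set3 := apply: eq_vtx_set => -[|[|[|//]]] _; rewrite !inE.
Local Ltac set4 := apply: eq_vtx_set => -[|[|[|[|//]]]] _; rewrite !inE.

(* Regular points of the root lattices: their images under distinct reflections
   are distinct. *)
Definition F4_point : Z * Z * Z * Z := (-1, 0, -2, 1)%Z.
Definition H4_point : Zphi4 := ((-2, 0), (1, 0), (-1, 0), (0, 0))%Z.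
Definition H3_point : Zphi4 := ((-1, 0), (0, 0), (-1, 0), (0, 0))%Z.

Section Path4.
Local Notation v := (vtx 3).

Definition even_odd4 : {set {set 'I_4}} := [set [set v 0; v 2]; [set v 1; v 3]]%SET.
Definition outer_inner4 : {set {set 'I_4}} := [set [set v 0; v 3]; [set v 1; v 2]]%SET.

Lemma even_odd4_partition : two_partition even_odd4.
Proof.
have -> : even_odd4 = [set [set v 0; v 2]; ~: [set v 0; v 2]]%SET.
  by congr ([set _; _]%SET); set4.
by apply: two_partition_setC; apply/eqP => /setP; [move/(_ (v 0))|move/(_ (v 1))];
  rewrite !inE.
Qed.

Lemma outer_inner4_partition : two_partition outer_inner4.
Proof.
have -> : outer_inner4 = [set [set v 0; v 3]; ~: [set v 0; v 3]]%SET.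
  by congr ([set _; _]%SET); set4.
by apply: two_partition_setC; apply/eqP => /setP; [move/(_ (v 0))|move/(_ (v 1))];
  rewrite !inE.
Qed.

(** Starting from vertex 0, the edges of the path force the part of each next vertex. Used for both
    F4 and H4. *)
Lemma bipartite_path4 (M : coxMatrix 'I_4) (P : {set {set 'I_4}}) :
  cox_edge M (v 0) (v 1) -> cox_edge M (v 1) (v 2) -> cox_edge M (v 2) (v 3) ->
  M (v 0) (v 2) = Some 2 -> M (v 1) (v 3) = Some 2 ->
  bipartite_partition M P <-> P = even_odd4.
Proof.
move=> e01 e12 e23 n02 n13; split=> [[P2 bip]|->].
  have [J [J0 _ PE]] := two_partition_compl (v 0) P2.
  have JP : J \in P by rewrite PE !inE eqxx.
  have CP : ~: J \in P by rewrite PE !inE eqxx orbT.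
  have J1 : v 1 \notin J by apply: contraL e01; apply: (bip J JP).
  have J2 : v 2 \in J.
    apply: contraLR e12 => J2; apply: (bip _ CP); rewrite inE //.
  have J3 : v 3 \notin J by apply: contraL e23; apply: (bip J JP).
  by rewrite PE; congr ([set _; _]%SET); set4; rewrite ?J0 ?J2 ?(negbTE J1) ?(negbTE J3).
split; first exact: even_odd4_partition.
have e_refl i : ~~ cox_edge M i i.
  by rewrite /cox_edge; have -> : M i i = Some 1%N by apply/cox_m_eq1.
move=> J; rewrite !inE => /orP[] /eqP -> i j; rewrite !inE;
  do 2![move=> /orP[] /eqP ->]; rewrite ?e_refl // /cox_edge;
  by rewrite ?[M (v 2) _]cox_m_sym ?[M (v 3) _]cox_m_sym ?n02 ?n13.
Qed.

End Path4.

Section F4.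
Local Notation v := (vtx 3).

(** The exponent 6 is half the Coxeter number 12; the length 6 (2 + 2) = 24 is the number of
    reflections. *)
Lemma F4_even_odd_admissible : admissible cox_F4 even_odd4.
Proof.
apply: (@dihedral_pair_admissible _ _ _ _ F4_point F4_model _ _ 2 _ _ 2 6) => //.
exact: even_odd4_partition.
Qed.

(** The middle vertices generate a dihedral group whose longest element has length 4, and 4 (2 + 4)
    = 24 again. *)
Lemma F4_outer_inner_admissible : admissible cox_F4 outer_inner4.
Proof.
apply: (@dihedral_pair_admissible _ _ _ _ F4_point F4_model _ _ 2 _ _ 4 4) => //.
exact: outer_inner4_partition.
Qed.

(** Eight cases for the vertices that join 0: one is not a partition, five are excluded by a
    commuting vertex, two remain. *)
Lemma F4_admissible_cases P : admissible cox_F4 P ->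
  P = even_odd4 \/ P = outer_inner4.
Proof.
move=> admP; have [P2 _ _] := admP.
have [J [J0 JT PE]] := two_partition_compl (v 0) P2.
have JP : J \in P by rewrite PE !inE eqxx.
have CP : ~: J \in P by rewrite PE !inE eqxx orbT.
have sep := separated_not_admissible (x0 := F4_point) F4_model F4_local.
case: (boolP (v 1 \in J)) => J1; case: (boolP (v 2 \in J)) => J2;
  case: (boolP (v 3 \in J)) => J3.
- by case/eqP: JT; set4; rewrite ?J0 ?J1 ?J2 ?J3.
(* The complement is the singleton of 3; in the other part, 2 is adjacent to 3 while 0 commutes with
   it. The other exclusions follow this pattern. *)
- exfalso; apply: (sep P (~: J) J (v 3) (v 3) 1%N (v 2) (v 0)) admP => //.
  by set4; rewrite ?J0 ?J1 ?J2 ?(negbTE J3).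
- exfalso; apply: (sep P (~: J) J (v 2) (v 2) 1%N (v 3) (v 0)) admP => //.
  by set4; rewrite ?J0 ?J1 ?(negbTE J2) ?J3.
- exfalso; apply: (sep P (~: J) J (v 2) (v 3) 3 (v 1) (v 0)) admP => //.
  by set4; rewrite ?J0 ?J1 ?(negbTE J2) ?(negbTE J3).
- exfalso; apply: (sep P (~: J) J (v 1) (v 1) 1%N (v 0) (v 3)) admP => //.
  by set4; rewrite ?J0 ?(negbTE J1) ?J2 ?J3.
- left; rewrite PE; congr ([set _; _]%SET);
    by set4; rewrite ?J0 ?(negbTE J1) ?J2 ?(negbTE J3).
- right; rewrite PE; congr ([set _; _]%SET);
    by set4; rewrite ?J0 ?(negbTE J1) ?(negbTE J2) ?J3.
- exfalso; apply: (sep P J (~: J) (v 0) (v 0) 1%N (v 1) (v 2)) admP => //.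
  + by set4; rewrite ?J0 ?(negbTE J1) ?(negbTE J2) ?(negbTE J3).
  + by rewrite inE.
  + by rewrite inE.
  + by rewrite inE J0.
  + by rewrite inE J0.
Qed.
End F4.

Section H4.
Local Notation v := (vtx 3).

(** The Coxeter number is 30, and 15 (2 + 2) = 60 is the number of reflections. *)
Lemma H4_even_odd_admissible : admissible cox_H4 even_odd4.
Proof.
apply: (@dihedral_pair_admissible _ _ _ _ H4_point H4_model _ _ 2 _ _ 2 15) => //.
exact: even_odd4_partition.
Qed.

(* For w = r_K r_J r_K r_J with K = {1, 2} and J = {0, 3}, one has
   l(w s_1) = l(w) + 1 and l(w s_2) = l(w) - 1. *)
Lemma H4_outer_inner_not_admissible : ~ admissible cox_H4 outer_inner4.
Proof.
pose a := alt 2 (v 0) (v 3); pose b := alt 3 (v 1) (v 2); pose w := b ++ a ++ b ++ a.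
have uniq_w1 : uniq (invs cox_H4 (w ++ [:: v 1])).
  by apply: (model_uniq (x := H4_point) H4_model); vm_compute.
have [uniq_w _] := uniq_invs_cat uniq_w1.
have [uniq_b /uniq_invs_cat[uniq_a _]] := uniq_invs_cat uniq_w.
have aJ := (longest_dihedral (M := cox_H4) (i := v 0) (j := v 3) (m := 2)
  erefl erefl (uniq_invs_length uniq_a)).2.
have bK := (longest_dihedral (M := cox_H4) (i := v 1) (j := v 2) (m := 3)
  erefl erefl (uniq_invs_length uniq_b)).2.
apply: (@mixed_not_admissible _ _ _ [set v 1; v 2]%SET (word cox_H4 w) (v 1) (v 2));
  rewrite ?inE ?eqxx ?orbT //.
- rewrite !wordM -aJ -bK; do ?[apply: generatedM]; apply: generated_subset;
    by [exists [set v 0; v 3]%SET; rewrite //= !inE eqxx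
       |exists [set v 1; v 2]%SET; rewrite //= !inE eqxx orbT].
- rewrite -(wordM _ _ [:: v 1]) (uniq_invs_length uniq_w1).
  by rewrite (uniq_invs_length uniq_w).
(* Nine letters which, followed by 2, give another expression of [w] with ten letters; hence w s_2
   has length at most 9. *)
pose u := map v [:: 2; 1; 0; 1; 2; 3; 2; 1; 0]%N.
have wu : word cox_H4 w = word cox_H4 (u ++ [:: v 2]).
  by apply: gather_word; apply/eqP; vm_compute.
rewrite (uniq_invs_length uniq_w) wu wordM -mulgA [X in _ * X]gen_invol mulg1.
exact: leq_trans (length_le _ _) _.
Qed.

Lemma H4_admissible P : admissible cox_H4 P -> P = even_odd4.
Proof.
move=> admP; have [P2 _ _] := admP.
have [J [J0 JT PE]] := two_partition_compl (v 0) P2.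
have JP : J \in P by rewrite PE !inE eqxx.
have CP : ~: J \in P by rewrite PE !inE eqxx orbT.
have sep := separated_not_admissible (x0 := H4_point) H4_model H4_local.
case: (boolP (v 1 \in J)) => J1; case: (boolP (v 2 \in J)) => J2;
  case: (boolP (v 3 \in J)) => J3.
- by case/eqP: JT; set4; rewrite ?J0 ?J1 ?J2 ?J3.
- exfalso; apply: (sep P (~: J) J (v 3) (v 3) 1%N (v 2) (v 0)) admP => //.
  by set4; rewrite ?J0 ?J1 ?J2 ?(negbTE J3).
- exfalso; apply: (sep P (~: J) J (v 2) (v 2) 1%N (v 3) (v 0)) admP => //.
  by set4; rewrite ?J0 ?J1 ?(negbTE J2) ?J3.
- exfalso; apply: (sep P (~: J) J (v 2) (v 3) 3 (v 1) (v 0)) admP => //.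
  by set4; rewrite ?J0 ?J1 ?(negbTE J2) ?(negbTE J3).
- exfalso; apply: (sep P (~: J) J (v 1) (v 1) 1%N (v 0) (v 3)) admP => //.
  by set4; rewrite ?J0 ?(negbTE J1) ?J2 ?J3.
- rewrite PE; congr ([set _; _]%SET);
    by set4; rewrite ?J0 ?(negbTE J1) ?J2 ?(negbTE J3).
- have PE' : P = outer_inner4.
    rewrite PE; congr ([set _; _]%SET);
      by set4; rewrite ?J0 ?(negbTE J1) ?(negbTE J2) ?J3.
  by case: H4_outer_inner_not_admissible; rewrite -PE'.
- exfalso; apply: (sep P J (~: J) (v 0) (v 0) 1%N (v 1) (v 2)) admP => //.
  + by set4; rewrite ?J0 ?(negbTE J1) ?(negbTE J2) ?(negbTE J3).
  + by rewrite inE.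
  + by rewrite inE.
  + by rewrite inE J0.
  + by rewrite inE J0.
Qed.

End H4.

Section H3.
Local Notation v := (vtx 2).

(** The singleton is written as a pair to fit [dihedral_pair_admissible], with label 1. *)
Definition even_odd3 : {set {set 'I_3}} := [set [set v 0; v 2]; [set v 1; v 1]]%SET.

Lemma even_odd3_partition : two_partition even_odd3.
Proof.
have -> : even_odd3 = [set [set v 0; v 2]; ~: [set v 0; v 2]]%SET.
  by congr ([set _; _]%SET); set3.
by apply: two_partition_setC; apply/eqP => /setP; [move/(_ (v 0))|move/(_ (v 1))];
  rewrite !inE.
Qed.

(** The Coxeter number is 10, and 5 (2 + 1) = 15 is the number of reflections. *)
Lemma H3_even_odd_admissible : admissible cox_H3 even_odd3.
Proof.
apply: (@dihedral_pair_admissible _ _ _ _ H3_point H3_model _ _ 2 _ _ 1 5) => //.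
exact: even_odd3_partition.
Qed.

Lemma H3_admissible P : admissible cox_H3 P -> P = even_odd3.
Proof.
move=> admP; have [P2 _ _] := admP.
have [J [J0 JT PE]] := two_partition_compl (v 0) P2.
have JP : J \in P by rewrite PE !inE eqxx.
have CP : ~: J \in P by rewrite PE !inE eqxx orbT.
have sep := separated_not_admissible (x0 := H3_point) H3_model H3_local.
case: (boolP (v 1 \in J)) => J1; case: (boolP (v 2 \in J)) => J2.
- by case/eqP: JT; set3; rewrite ?J0 ?J1 ?J2.
- exfalso; apply: (sep P (~: J) J (v 2) (v 2) 1%N (v 1) (v 0)) admP => //.
  by set3; rewrite ?J0 ?J1 ?(negbTE J2).
- rewrite PE; congr ([set _; _]%SET);
    by set3; rewrite ?J0 ?(negbTE J1) ?J2.
- exfalso; apply: (sep P J (~: J) (v 0) (v 0) 1%N (v 1) (v 2)) admP => //.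
  + by set3; rewrite ?J0 ?(negbTE J1) ?(negbTE J2).
  + by rewrite inE.
  + by rewrite inE.
  + by rewrite inE J0.
  + by rewrite inE J0.
Qed.

Lemma H3_bipartite P : bipartite_partition cox_H3 P <-> P = even_odd3.
Proof.
split=> [[P2 bip]|->].
  have [J [J0 _ PE]] := two_partition_compl (v 0) P2.
  have JP : J \in P by rewrite PE !inE eqxx.
  have CP : ~: J \in P by rewrite PE !inE eqxx orbT.
  have J1 : v 1 \notin J by apply/negP => J1; have := bip J JP _ _ J0 J1.
  have J2 : v 2 \in J.
    apply/negPn/negP => J2; have := bip _ CP (v 1) (v 2).
    by rewrite !inE => /(_ J1 J2).
  by rewrite PE; congr ([set _; _]%SET); set3; rewrite ?J0 ?J2 ?(negbTE J1).
split; first exact: even_odd3_partition.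
by move=> J; rewrite !inE => /orP[] /eqP -> i j; rewrite !inE;
  do 2![move=> /orP[] /eqP ->].
Qed.

End H3.

Lemma I2_two_partition (P : {set {set 'I_2}}) J :
  two_partition P -> J \in P -> exists i, J = [set i]%SET.
Proof.
move=> P2; have [K [K0 KT ->]] := two_partition_compl (vtx 1 0) P2.
have K1 : vtx 1 1 \notin K.
  by apply: contra KT => K1; apply/eqP; apply: eq_vtx_set => -[|[|//]] _; rewrite ?K0 ?K1 inE.
rewrite !inE => /orP[] /eqP ->; [exists (vtx 1 0)|exists (vtx 1 1)];
  by apply: eq_vtx_set => -[|[|//]] _; rewrite !inE ?K0 ?(negbTE K1).
Qed.

(** * The automorphism of F4 and its orbits *)

Section Automorphism.
Local Notation v := (vtx 3).

Definition F4_flip : {perm 'I_4} := perm (@rev_ord_inj 4).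

(** The only edge labelled 4 must be kept or reversed, and the edges labelled 3 then determine the
    images of the end vertices. *)
Lemma F4_automorphism (t : {perm 'I_4}) :
  cox_automorphism cox_F4 t /\ t <> 1 <-> t = F4_flip.
Proof.
have eq_vtx (i : 'I_4) k : k < 4 -> i = k :> nat -> i = v k.
  by move=> k4 ik; apply: val_inj; rewrite /= modn_small.
split=> [[autt t1]|->]; last first.
  split; last by move/perm.permP/(_ (v 0)); rewrite permE perm1 => /(congr1 val).
  by move=> [[|[|[|[|//]]]] ?] [[|[|[|[|//]]]] ?]; rewrite !permE.
have e01 := autt (v 0) (v 1); have e12 := autt (v 1) (v 2).
have e23 := autt (v 2) (v 3).
move: e01 e12 e23; rewrite [RHS]/= => e01 e12 e23.
have : (t (v 0), t (v 1), t (v 2), t (v 3)) = (v 0, v 1, v 2, v 3) \/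
       (t (v 0), t (v 1), t (v 2), t (v 3)) = (v 3, v 2, v 1, v 0).
  move: e01 e12 e23.
  case: (t (v 1)) => [[|[|[|[|//]]]] ?]; case: (t (v 2)) => [[|[|[|[|//]]]] ?] //;
  case: (t (v 0)) => [[|[|[|[|//]]]] ?] //; case: (t (v 3)) => [[|[|[|[|//]]]] ?] // _ _ _;
  by [left; congr (_, _, _, _); apply: val_inj|right; congr (_, _, _, _); apply: val_inj].
have ext (s : {perm 'I_4}) : t (v 0) = s (v 0) -> t (v 1) = s (v 1) ->
    t (v 2) = s (v 2) -> t (v 3) = s (v 3) -> t = s.
  move=> s0 s1 s2 s3; apply/perm.permP => x.
  have -> : x = v x by apply: eq_vtx.
  by case: (x : nat) (ltn_ord x) => [|[|[|[|//]]]].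
case=> -[t0 t1' t2 t3]; last first.
  by apply: ext; rewrite ?t0 ?t1' ?t2 ?t3 permE; apply: val_inj.
by case: t1; apply: ext; rewrite ?t0 ?t1' ?t2 ?t3 perm1.
Qed.

Lemma F4_orbitsE : F4_orbits = outer_inner4.
Proof.
(* This local [inE] shadows the membership lemma in the final rewriting. *)
have inE k : k < 4 -> inord k = v k.
  by move=> k4; apply: val_inj; rewrite /= inordK ?modn_small.
by rewrite /F4_orbits !inE.
Qed.

Lemma porbits_F4_flip : porbits F4_flip = F4_orbits.
Proof.
have porbitE x : porbit F4_flip x = [set x; F4_flip x]%SET.
  (* The flip is an involution, so only the parity of an exponent matters. *)
  have ff : F4_flip ^+ 2 = 1.
    by apply/perm.permP => y; rewrite permM !permE rev_ordK.
  apply/setP => y; rewrite !inE; apply/porbitP/orP => [[n ->]|].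
    rewrite -(odd_double_half n) expgD -mul2n expgM ff expg1n mulg1.
    by case: odd; [right; rewrite expg1|left; rewrite expg0 perm1].
  by case=> /eqP ->; [exists 0; rewrite perm1|exists 1%N].
have flipE k : k < 4 -> F4_flip (v k) = v (3 - k).
  move=> k4; rewrite permE; apply: val_inj.
  by rewrite /= !modn_small // ltnS leq_subr.
rewrite F4_orbitsE; apply/setP => A; rewrite !inE.
apply/imsetP/orP => [[x _ ->]|].
  have -> : x = v x by apply: val_inj; rewrite /= modn_small.
  case: (x : nat) (ltn_ord x) => [|[|[|[|//]]]] _; rewrite porbitE flipE //.
  - by left.
  - by right.
  - by right; rewrite finset.setUC.
  - by left; rewrite finset.setUC.
by case=> /eqP ->; [exists (v 0)|exists (v 1)]; rewrite // porbitE flipE.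
Qed.

End Automorphism.

Local Close Scope group_scope.

Theorem proposition53 :
  [/\ forall P : {set {set 'I_4}},
        admissible cox_F4 P <->
        bipartite_partition cox_F4 P \/ P = F4_orbits,
      exists s : {perm 'I_4},
        (forall t : {perm 'I_4},
           cox_automorphism cox_F4 t /\ t <> 1%g <-> t = s) /\
        porbits s = F4_orbits,
      forall P : {set {set 'I_3}},
        admissible cox_H3 P <-> bipartite_partition cox_H3 P,
      forall P : {set {set 'I_4}},
        admissible cox_H4 P <-> bipartite_partition cox_H4 P
    & forall (m : nat) (m_ge3 : 3 <= m) (P : {set {set 'I_2}}),
        admissible (cox_I2 m_ge3) P <->
        bipartite_partition (cox_I2 m_ge3) P].
Proof.
split=> [P||P|P|m m_ge3 P].
- rewrite bipartite_path4 // F4_orbitsE; split; first exact: F4_admissible_cases.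
  by case=> ->; [apply: F4_even_odd_admissible|apply: F4_outer_inner_admissible].
- by exists F4_flip; split; [apply: F4_automorphism|apply: porbits_F4_flip].
- rewrite H3_bipartite; split; first exact: H3_admissible.
  by move=> ->; apply: H3_even_odd_admissible.
- rewrite bipartite_path4 //; split; first exact: H4_admissible.
  by move=> ->; apply: H4_even_odd_admissible.
(* For I2 both parts are singletons, so both conditions hold for every 2-partition. *)
split=> [[P2 _ _]|[P2 _]]; last first.
  by apply: (singletons_admissible _ P2) => J; apply: I2_two_partition.
split=> // J /(I2_two_partition P2)[k ->] i j; rewrite !inE => /eqP -> /eqP ->.
rewrite /cox_edge; suff -> : cox_I2 m_ge3 k k = Some 1%N by [].
exact/cox_m_eq1.
Qed.
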